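(* As formal power series in $q$ with integer coefficients, \[ \sum_{n=0}^\infty \bar{p}(40n+35)q^n \equiv 2\frac{f_2^{122}}{f_1^{63}f_4^{40}} +3 \frac{f_1f_2^{26}}{f_4^8} +4q\frac{f_2^{98}}{f_1^{55}f_4^{24}} +3qf_1^9f_2^2f_4^8 +4q^2\frac{f_2^{74}}{f_1^{47}f_4^8} +4q^3\frac{f_2^{50}f_4^8}{f_1^{39}} +4q^4\frac{f_2^{26}f_4^{24}}{f_1^{31}} + 2q^{5} \frac{f_2^2f_4^{40}}{f_1^{23}} \pmod{5}, \] where the congruence means coefficientwise congruence modulo $5$.
   Context: For a positive integer $n$, $f_n=\prod_{k=1}^\infty (1-q^{nk})$. An overpartition of a positive integer $n$ is a partition of $n$ in which the first occurrence of each distinct part may be overlined; $\bar{p}(n)$ is the number of overpartitions of $n$ for $n\geq1$, and $\bar{p}(0)=1$. Equivalently, $\sum_{n\geq 0}\bar{p}(n)q^n=f_2/f_1^2$. *)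

(* Defs.v *)
From mathcomp Require Import all_boot all_order all_algebra.
Set Implicit Arguments. Unset Strict Implicit. Unset Printing Implicit Defensive.
Import Order.TTheory GRing.Theory Num.Theory.
Local Open Scope ring_scope.

Definition series := nat -> int.

Definition sadd (a b : series) : series := fun n => a n + b n.
Definition sscale (c : int) (a : series) : series := fun n => c * a n.
Definition smul (a b : series) : series :=
  fun n => \sum_(i < n.+1) a i * b (n - i)%N.
Definition sone : series := fun n => (n == 0%N)%:R.
Definition sq : series := fun n => (n == 1%N)%:R.
Definition spow (a : series) (k : nat) : series := iter k (smul a) sone.

(* Multiplicative inverse of a series with constant term 1:
   b_0 = 1, b_n = - sum_{i=1}^n a_i b_{n-i}.  invs a n = [:: b_0; ...; b_n]. *)
Fixpoint invs (a : series) (n : nat) : seq int :=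
  match n with
  | 0 => [:: 1]
  | n'.+1 => let s := invs a n' in
             rcons s (- \sum_(1 <= i < n'.+2) a i * nth 0 s (n'.+1 - i)%N)
  end.
Definition sinv (a : series) : series := fun n => nth 0 (invs a n) n.

(* f_m = prod_{k>=1} (1 - q^{mk}); the coefficient of q^N only depends on
   the factors with k <= N, so it is the N-th coefficient of the finite
   product prod_{k=1}^{N} (1 - q^{mk}) (for m >= 1). *)
Definition f (m : nat) : series :=
  fun N => (\prod_(k < N) (1 - 'X^(m * k.+1)%N) : {poly int})`_N.

(* overpartition generating function: sum pbar(n) q^n = f_2 / f_1^2 *)
Definition pbar (n : nat) : int := smul (f 2) (spow (sinv (f 1)) 2) n.

Definition cong5 (a b : series) : Prop := forall n, (a n = b n %[mod 5])%Z.

(* Main.v *)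
Require Import Defs.
From HB Require Import structures.
From mathcomp Require Import all_boot all_order all_algebra.
From mathcomp Require Import boolp ring zify.
Set Implicit Arguments. Unset Strict Implicit. Unset Printing Implicit Defensive.
Import GRing.Theory.
Local Open Scope ring_scope.

(** Both sides vanish modulo 5. Write phi and psi for Gauss's theta series, so
    that phi(-q) = f_1^2/f_2 and psi(q) = f_2^2/f_1.

    Left-hand side: P = f_2/f_1^2 = 1/phi(-q) satisfies P = P^5 phi(-q)^4, and
    P^5 = P(q^5) modulo 5. The 5-dissection of phi and the relation
    r_2(5n) + r_2(n/5) = 2 r_2(n) show that the coefficients of q^(5n) and q^n
    in phi^4 agree modulo 5, hence the sum of the pbar(5n) q^n is
    phi(-q)^3. Its coefficient at q^(8n+7) is zero because no integer congruent
    to 7 modulo 8 is a sum of three squares.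

    Right-hand side: put u = f_2^24, v = f_1^16 f_4^8 and z = q f_1^8 f_4^16.
    Up to the factor f_2^2/(f_1^63 f_4^40) the sum is
    2 (u+z) (u^4 + u^3 z + u^2 z^2 + u z^3 + z^4) + 3 (u+z) v^4, which is
    5 (u+z) (u-z)^4 = 0 modulo 5, because
    phi(q)^4 - phi(-q)^4 = 16 q psi(q^2)^4 says that u - v = 16 z. *)

(** * Formal power series *)

Definition fps (R : comNzRingType) : Type := nat -> R.

HB.instance Definition _ (R : comNzRingType) := gen_eqMixin (fps R).
HB.instance Definition _ (R : comNzRingType) := gen_choiceMixin (fps R).

Section FpsRing.
Variable R : comNzRingType.
Implicit Types a b c : fps R.

Definition fps_zero : fps R := fun _ => 0.
Definition fps_opp a : fps R := fun n => - a n.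
Definition fps_add a b : fps R := fun n => a n + b n.
Definition fps_one : fps R := fun n => (n == 0)%:R.
Definition fps_mul a b : fps R := fun n => \sum_(i < n.+1) a i * b (n - i)%N.

Fact fps_addA : associative fps_add.
Proof. by move=> a b c; apply/funext => n; rewrite /fps_add addrA. Qed.
Fact fps_addC : commutative fps_add.
Proof. by move=> a b; apply/funext => n; rewrite /fps_add addrC. Qed.
Fact fps_add0 : left_id fps_zero fps_add.
Proof. by move=> a; apply/funext => n; rewrite /fps_add add0r. Qed.
Fact fps_addN : left_inverse fps_zero fps_opp fps_add.
Proof. by move=> a; apply/funext => n; rewrite /fps_add addNr. Qed.

HB.instance Definition _ :=
  GRing.isZmodule.Build (fps R) fps_addA fps_addC fps_add0 fps_addN.

(** Coefficients of a product up to q^n depend only on these truncations, so the ring laws are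
    inherited from polynomials. *)
Definition trunc n a : {poly R} := \poly_(i < n.+1) a i.

Lemma fps_mul_trunc n m a b : (n <= m)%N ->
  fps_mul a b n = (trunc m a * trunc m b)`_n.
Proof.
move=> lenm; rewrite coefM; apply: eq_bigr => i _.
by have lti := ltn_ord i; rewrite !coef_poly !ifT //; lia.
Qed.

Lemma trunc_fps_mul n m a b : (m <= n)%N ->
  (trunc n (fps_mul a b))`_m = (trunc n a * trunc n b)`_m.
Proof. by move=> le; rewrite coef_poly ltnS le (fps_mul_trunc _ _ le). Qed.

Fact fps_mulA : associative fps_mul.
Proof.
move=> a b c; apply/funext => n.
rewrite !(fps_mul_trunc _ _ (leqnn n)).
transitivity ((trunc n a * (trunc n b * trunc n c))`_n).
  rewrite !(coefM (trunc n a)); apply: eq_bigr => i _.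
  by rewrite trunc_fps_mul ?leq_subr.
rewrite mulrA !(coefMr _ (trunc n c)); apply: eq_bigr => i _.
by rewrite trunc_fps_mul ?leq_subr.
Qed.

Fact fps_mulC : commutative fps_mul.
Proof.
move=> a b; apply/funext => n.
by rewrite !(fps_mul_trunc _ _ (leqnn n)) mulrC.
Qed.

Fact fps_mul1 : left_id fps_one fps_mul.
Proof.
move=> a; apply/funext => n; rewrite /fps_mul big_ord_recl /= subn0 mul1r.
by rewrite big1 ?addr0 // => i _; rewrite mul0r.
Qed.

Fact fps_mulDl : left_distributive fps_mul fps_add.
Proof.
move=> a b c; apply/funext => n; rewrite /fps_add /fps_mul -big_split /=.
by apply: eq_bigr => i _; rewrite mulrDl.
Qed.

Fact fps_one_neq0 : fps_one != 0.
Proof.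
by apply/eqP => /(congr1 (fun a => a 0)) /eqP; rewrite (oner_eq0 R).
Qed.

HB.instance Definition _ := GRing.Zmodule_isComNzRing.Build (fps R)
  fps_mulA fps_mulC fps_mul1 fps_mulDl fps_one_neq0.

Lemma fps_addE a b n : (a + b) n = a n + b n. Proof. by []. Qed.
Lemma fps_oppE a n : (- a) n = - a n. Proof. by []. Qed.
Lemma fps_subE a b n : (a - b) n = a n - b n. Proof. by []. Qed.
Lemma fps_mulE a b n : (a * b) n = \sum_(i < n.+1) a i * b (n - i)%N.
Proof. by []. Qed.
Lemma fps_oneE n : (1 : fps R) n = (n == 0)%:R. Proof. by []. Qed.

Lemma fps_sumE I (r : seq I) (P : pred I) (F : I -> fps R) n :
  (\sum_(i <- r | P i) F i) n = \sum_(i <- r | P i) F i n.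
Proof. by elim/big_rec2: _ => // i x y _ <-. Qed.

Lemma coef_mul_trunc n m a b : (n <= m)%N ->
  (a * b) n = (trunc m a * trunc m b)`_n.
Proof. exact: fps_mul_trunc. Qed.

End FpsRing.

(** * Substitutions, coefficient extraction and lacunary series *)

Section FpsOperators.
Variable R : comNzRingType.
Implicit Types a b c : fps R.

Definition fpsX : fps R := fun n => (n == 1)%:R.

Lemma fpsX_mulE a n : (fpsX * a) n = if n is m.+1 then a m else 0.
Proof.
rewrite fps_mulE; case: n => [|n]; first by rewrite big_ord1 mul0r.
rewrite big_ord_recl mul0r add0r big_ord_recl /= mul1r subn1 /=.
by rewrite big1 ?addr0 // => i _; rewrite mul0r.
Qed.

Definition fpsC (x : R) : fps R := fun n => if n is 0 then x else 0.

Lemma fpsC_mulE x a n : (fpsC x * a) n = x * a n.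
Proof.
rewrite fps_mulE big_ord_recl subn0 big1 ?addr0 // => i _.
by rewrite mul0r.
Qed.

Lemma fpsC_is_zmod_morphism : zmod_morphism fpsC.
Proof. by move=> x y; apply/funext => -[|n]; rewrite fps_subE //= subr0. Qed.

Lemma fpsC_is_monoid_morphism : monoid_morphism fpsC.
Proof.
split=> [|x y]; first by apply/funext => -[].
by apply/funext => -[|n]; rewrite fpsC_mulE //= mulr0.
Qed.

HB.instance Definition _ :=
  GRing.isZmodMorphism.Build R (fps R) fpsC fpsC_is_zmod_morphism.
HB.instance Definition _ :=
  GRing.isMonoidMorphism.Build R (fps R) fpsC fpsC_is_monoid_morphism.

Lemma fps_split0 a : a = fpsC (a 0%N) + fpsX * (fun i => a i.+1).
Proof.
apply/funext => i; rewrite fps_addE fpsX_mulE.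
by case: i => [|i]; rewrite ?addr0 ?add0r.
Qed.

Lemma fpsXn_mulE k a n :
  (fpsX ^+ k * a) n = if (k <= n)%N then a (n - k)%N else 0.
Proof.
elim: k n => [|k IHk] n; first by rewrite mul1r subn0.
by rewrite exprS -mulrA fpsX_mulE; case: n => // n; rewrite IHk subSS.
Qed.

Lemma fpsXnE k n : (fpsX ^+ k) n = (n == k)%:R.
Proof.
rewrite -[fpsX ^+ k]mulr1 fpsXn_mulE fps_oneE.
case: leqP => lekn; first by congr (nat_of_bool _)%:R; lia.
by rewrite (_ : n == k = false) //; lia.
Qed.

(** The substitution of q^k for q; [subN] below is the substitution of -q for q, and [fpsU] is
    Atkin's operator U_k. *)
Definition subX k a : fps R := fun n => if (k %| n)%N then a (n %/ k)%N else 0.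

Definition subN a : fps R := fun n => (-1) ^+ n * a n.

Definition fpsU k a : fps R := fun n => a (k * n)%N.

Lemma fps_comp_trunc k m a n : (0 < k)%N -> (n <= m)%N ->
  (trunc m (subX k a))`_n = (trunc m a \Po 'X^k)`_n.
Proof.
move=> k0 le; rewrite coef_comp_poly_Xn // !coef_poly ltnS le /subX.
by case: ifP => // dv; rewrite ifT // ltnS (leq_trans _ le) ?leq_div.
Qed.

Lemma subX_is_zmod_morphism k : zmod_morphism (subX k).
Proof.
move=> a b; apply/funext => n; rewrite fps_subE /subX.
by case: ifP => _; rewrite ?fps_subE ?subr0.
Qed.

HB.instance Definition _ k :=
  GRing.isZmodMorphism.Build (fps R) (fps R) (subX k) (@subX_is_zmod_morphism k).

Lemma subX1 k : (0 < k)%N -> subX k 1 = 1.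
Proof.
move=> k0; apply/funext => n; rewrite /subX !fps_oneE.
case: ifP => [/dvdnP[m ->]|].
  by rewrite mulnK // muln_eq0 (gtn_eqF k0) orbF.
by case: n => //; rewrite dvdn0.
Qed.

Lemma subX_fpsC k x : (0 < k)%N -> subX k (fpsC x) = fpsC x.
Proof.
move=> k0; apply/funext => -[|n]; rewrite /subX ?dvdn0 ?div0n //=.
by case: ifP => // dv; case E: (_ %/ _)%N => //; move: (divnK dv); rewrite E.
Qed.

Lemma subXM k a b : (0 < k)%N -> subX k (a * b) = subX k a * subX k b.
Proof.
move=> k0; apply/funext => n.
rewrite (coef_mul_trunc _ _ (leqnn n)).
transitivity (((trunc n a * trunc n b) \Po 'X^k)`_n).
  rewrite coef_comp_poly_Xn // /subX; case: ifP => // _.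
  by rewrite (coef_mul_trunc _ _ (leq_div n k)).
rewrite comp_polyM !coefM; apply: eq_bigr => i _.
by rewrite !fps_comp_trunc ?leq_subr // -ltnS.
Qed.

Lemma subXX k a n : (0 < k)%N -> subX k (a ^+ n) = subX k a ^+ n.
Proof.
by move=> k0; elim: n => [|n IHn]; rewrite ?subX1 // !exprS subXM // IHn.
Qed.

Lemma subX_comp k l a : (0 < k)%N -> (0 < l)%N ->
  subX k (subX l a) = subX (k * l) a.
Proof.
move=> k0 l0; apply/funext => n; rewrite /subX.
case: (boolP (k %| n)%N) => [/dvdnP[m ->]|ndv].
  by rewrite mulnK // [(m * k)%N]mulnC dvdn_pmul2l // divnMl.
by rewrite ifF //; apply: contraNF ndv; apply: dvdn_trans; apply: dvdn_mulr.
Qed.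

Lemma subX_fpsX k : (0 < k)%N -> subX k fpsX = fpsX ^+ k.
Proof.
move=> k0; apply/funext => n; rewrite fpsXnE /subX /fpsX.
case: (boolP (k %| n)%N) => [/dvdnP[m ->]|ndv].
  by rewrite mulnK //; have := @eqn_pmul2r k m 1 k0; rewrite mul1n => ->.
by rewrite (_ : n == k = false) //; apply: contraNF ndv => /eqP->.
Qed.

Lemma subN_is_zmod_morphism : zmod_morphism subN.
Proof. by move=> a b; apply/funext => n; rewrite /subN !fps_subE mulrBr. Qed.

Lemma subN_is_monoid_morphism : monoid_morphism subN.
Proof.
split=> [|a b]; apply/funext => n; rewrite /subN.
  by rewrite fps_oneE; case: n => [|n]; rewrite ?mulr0 // mul1r.
rewrite !fps_mulE mulr_sumr; apply: eq_bigr => i _.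
rewrite -{1}(subnKC (ltn_ord i : (i <= n)%N)) exprD; ring.
Qed.

HB.instance Definition _ :=
  GRing.isZmodMorphism.Build (fps R) (fps R) subN subN_is_zmod_morphism.
HB.instance Definition _ :=
  GRing.isMonoidMorphism.Build (fps R) (fps R) subN subN_is_monoid_morphism.

Lemma subN_subX k a : ~~ odd k -> subN (subX k a) = subX k a.
Proof.
move=> ek; apply/funext => n; rewrite /subN /subX; case: ifP; rewrite ?mulr0 //.
by case/dvdnP=> m ->; rewrite -signr_odd oddM (negPf ek) andbF mul1r.
Qed.

Lemma subN_fpsX : subN fpsX = - fpsX.
Proof.
apply/funext => -[|[|n]]; rewrite /subN fps_oppE /fpsX /=.
- by rewrite mulr0 oppr0.
- by rewrite mulr1 expr1.
- by rewrite mulr0 oppr0.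
Qed.

Lemma fpsUD k a b : fpsU k (a + b) = fpsU k a + fpsU k b.
Proof. by []. Qed.

Lemma fpsU_mul_subX k a b : (0 < k)%N -> fpsU k (subX k a * b) = a * fpsU k b.
Proof.
move=> k0; apply/funext => n; rewrite /fpsU.
elim: n a => [|n IHn] a.
  by rewrite muln0 !fps_mulE !big_ord1 /subX dvdn0 div0n muln0.
(* With a = a_0 + q a', the substitution turns q a' into q^k a'(q^k), which moves the index k(n+1)
   down to kn. *)
rewrite (fps_split0 a) raddfD /= subXM // subX_fpsX // subX_fpsC // !mulrDl.
rewrite !fps_addE -!mulrA fpsXn_mulE fpsX_mulE mulnS leq_addr addKn IHn.
by rewrite !fpsC_mulE mulnS.
Qed.

Lemma fpsU_subX k a : (0 < k)%N -> fpsU k (subX k a) = a.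
Proof.
by move=> k0; apply/funext => n; rewrite /fpsU /subX dvdn_mulr // mulKn.
Qed.

(** All exponents that occur are congruent to j modulo k, hence none is a multiple of k. *)
Lemma fpsU_Xn_subX k j a : (0 < j < k)%N -> fpsU k (fpsX ^+ j * subX k a) = 0.
Proof.
case/andP=> j0 jk; apply/funext => n; rewrite /fpsU fpsXn_mulE /subX.
case: leqP => // le; case: ifP => // dv.
have /(dvdn_sub (dvdn_mulr n (dvdnn k))) := dv.
by rewrite subKn // => /(dvdn_leq j0); rewrite leqNgt jk.
Qed.

(** Congruence modulo q^(n+1), used to compare infinite series with finite sums and products. *)
Definition eqmodX n a b := forall i, (i <= n)%N -> a i = b i.

Lemma eqmodX_mul n a b c d :
  eqmodX n a c -> eqmodX n b d -> eqmodX n (a * b) (c * d).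
Proof.
move=> ac bd i le; rewrite !fps_mulE; apply: eq_bigr => j _.
have ltj := ltn_ord j.
by rewrite ac ?bd //; lia.
Qed.

Lemma eqmodX_Xn n k a b c : (n < k)%N -> eqmodX n a b ->
  eqmodX n (a + fpsX ^+ k * c) b.
Proof.
move=> ltnk ab i le; rewrite fps_addE fpsXn_mulE ifF ?addr0 ?ab //; lia.
Qed.

Lemma eqmodX_trans n a b c : eqmodX n a b -> eqmodX n b c -> eqmodX n a c.
Proof. by move=> ab bc i le; rewrite ab // bc. Qed.

Lemma eqmodX_sym n a b : eqmodX n a b -> eqmodX n b a.
Proof. by move=> ab i le; rewrite ab. Qed.

Lemma eqmodX_eq a b : (forall n, exists2 m, (n <= m)%N & eqmodX m a b) -> a = b.
Proof. by move=> ab; apply/funext => n; have [m le /(_ _ le)] := ab n. Qed.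

(* The sum of the c_s q^(e_s), provided that e_s >= s: the terms with s > n are
   left out of the coefficient of q^n. *)
Definition lac (c : nat -> R) (e : nat -> nat) : fps R :=
  fun n => \sum_(s < n.+1) c s * (e s == n)%:R.

Lemma lacE c e n m : (forall s, (s <= e s)%N) -> (n < m)%N ->
  lac c e n = \sum_(s < m) c s * (e s == n)%:R.
Proof.
move=> es lt; rewrite /lac (big_ord_widen m (fun s => c s * (e s == n)%:R) lt).
rewrite big_mkcond; apply: eq_bigr => s _; case: ltnP => // lens.
by rewrite (_ : e s == n = false) ?mulr0 //; have := es s; lia.
Qed.

Lemma lac_eqmodX c e n m : (forall s, (s <= e s)%N) -> (n < m)%N ->
  eqmodX n (lac c e) (\sum_(s < m) fpsC (c s) * fpsX ^+ e s).
Proof.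
move=> es lt i le; rewrite (lacE _ es (leq_ltn_trans le lt)) fps_sumE.
by apply: eq_bigr => s _; rewrite fpsC_mulE fpsXnE eq_sym.
Qed.

Lemma subX_lac k c e : (0 < k)%N -> (forall s, (s <= e s)%N) ->
  subX k (lac c e) = lac c (fun s => k * e s)%N.
Proof.
move=> k0 es; apply/funext => n; rewrite /subX; case: ifP => [/dvdnP[m ->]|ndv].
  rewrite mulnK // (@lacE _ _ _ (m * k).+1) // ?ltnS ?leq_pmulr // /lac.
  by apply: eq_bigr => s _; rewrite [(k * _)%N]mulnC eqn_pmul2r.
rewrite /lac big1 // => s _; case: eqP => [eq|]; rewrite ?mulr0 //.
by have := dvdn_mulr (e s) (dvdnn k); rewrite eq ndv.
Qed.

Lemma fpsXn_lac k c e : (forall s, (s <= e s)%N) ->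
  fpsX ^+ k * lac c e = lac c (fun s => k + e s)%N.
Proof.
move=> es; apply/funext => n; rewrite fpsXn_mulE; case: leqP => le.
  rewrite (@lacE _ _ _ n.+1) // ?ltnS ?leq_subr //; apply: eq_bigr => s _.
  by congr (_ * (nat_of_bool _)%:R); lia.
rewrite /lac big1 // => s _; rewrite (_ : (_ + _ == _)%N = false) ?mulr0 //; lia.
Qed.

Lemma lac_scale x c e : lac (fun s => x * c s) e = fpsC x * lac c e.
Proof.
apply/funext => n; rewrite fpsC_mulE /lac mulr_sumr.
by apply: eq_bigr => s _; rewrite mulrA.
Qed.

Lemma sum_dissect (F : nat -> R) k m :
  \sum_(s < m * k) F s = \sum_(r < k) \sum_(s < m) F (k * s + r)%N.
Proof.
elim: m => [|m IHm]; first by rewrite big_ord0 big1 // => r _; rewrite big_ord0.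
under [RHS]eq_bigr => r _ do rewrite big_ord_recr.
rewrite big_split /= -IHm -!(big_mkord xpredT).
rewrite (@big_cat_nat _ _ _ (m * k)%N) //=; last first.
  by rewrite mulSn leq_addl.
congr (_ + _); rewrite -{1}[(m * k)%N]add0n big_addn mulSn addnK big_mkord.
by apply: eq_bigr => r _; rewrite addnC mulnC.
Qed.

Lemma lac_dissect k c e : (0 < k)%N -> (forall s, (s <= e s)%N) ->
  lac c e = \sum_(r < k)
    lac (fun s => c (k * s + r)%N) (fun s => e (k * s + r)%N).
Proof.
move=> k0 es; apply/funext => n; rewrite fps_sumE.
(* The summation range is lengthened so that it splits into k full residue classes. *)
have lt : (n < n.+1 * k)%N by rewrite (leq_trans (ltnSn n)) ?leq_pmulr.
by rewrite (lacE _ es lt) (sum_dissect (fun s => c s * (e s == n)%:R)).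
Qed.

Lemma eq_lac c c' e e' : c =1 c' -> e =1 e' -> lac c e = lac c' e'.
Proof. by move=> /funext-> /funext->. Qed.
End FpsOperators.

(** * Shanks's finite forms of Gauss's theta identities *)

Section Shanks.
Variables (R : comNzRingType) (q : R).

(** In Pochhammer notation: (q^k; q^k)_n here, then (-q; q)_n for [pochp], (q; q^2)_n for [pocho],
    and for [tailm] the quotient of (q^k; q^k)_n by (q^k; q^k)_s, written without division. *)
Definition pochm (k n : nat) : R := \prod_(i < n) (1 - q ^+ (k * i.+1)).

Lemma pochmS k n : pochm k n.+1 = pochm k n * (1 - q ^+ (k * n.+1)).
Proof. by rewrite /pochm big_ord_recr. Qed.

Definition pochp (n : nat) : R := \prod_(i < n) (1 + q ^+ i.+1).

Lemma pochpS n : pochp n.+1 = pochp n * (1 + q ^+ n.+1).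
Proof. by rewrite /pochp big_ord_recr. Qed.

Definition pocho (n : nat) : R := \prod_(i < n) (1 - q ^+ i.*2.+1).

Lemma pochoS n : pocho n.+1 = pocho n * (1 - q ^+ n.*2.+1).
Proof. by rewrite /pocho big_ord_recr. Qed.

Definition tailm (k s n : nat) : R := \prod_(s <= i < n) (1 - q ^+ (k * i.+1)).

Lemma tailm_recr k s n : (s <= n)%N ->
  tailm k s n.+1 = tailm k s n * (1 - q ^+ (k * n.+1)).
Proof. by move=> le; rewrite /tailm big_nat_recr. Qed.

Lemma tailm_recl k s n : (s < n)%N ->
  tailm k s n = (1 - q ^+ (k * s.+1)) * tailm k s.+1 n.
Proof. by move=> lt; rewrite /tailm big_ltn. Qed.

Lemma tailmnn k n : tailm k n n = 1.
Proof. by rewrite /tailm big_geq. Qed.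

Lemma tailm0 k n : tailm k 0 n = pochm k n.
Proof. by rewrite /tailm big_mkord. Qed.

(* Shanks's closed forms for the partial sums of phi(-q) and psi(q), multiplied
   by (1 + q) ... (1 + q^n) and (1 - q) (1 - q^3) ... (1 - q^(2n-1)) to clear the
   denominators. *)
Definition shanks_phi n := pochm 1 n +
  2 * \sum_(s < n) (-1) ^+ s.+1 * tailm 1 s.+1 n * pochp s * q ^+ (s.+1 * n.+1).

(** The summand is the s-th term of the sum in [shanks_phi n.+1] minus 1 + q^(n+1) times that in
    [shanks_phi n]; it is a difference of consecutive boundary terms. *)
Lemma shanks_phi_telescope n j : (j <= n)%N ->
  \sum_(s < j) (-1) ^+ s.+1 * tailm 1 s.+1 n * pochp s * q ^+ (s.+1 * n.+1) *
    (q ^+ s.+1 * (1 - q ^+ n.+1) - (1 + q ^+ n.+1))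
  = q ^+ n.+1 * tailm 1 0 n
    - (-1) ^+ j * tailm 1 j n * pochp j * q ^+ (j.+1 * n.+1).
Proof.
elim: j => [|j IHj] lejn.
  by rewrite big_ord0 /pochp big_ord0 mul1n; ring.
rewrite big_ord_recr /= IHj ?(ltnW lejn) // (tailm_recl _ lejn) pochpS mul1n.
rewrite !(mulSn _ n.+1) !exprD !exprS; ring.
Qed.

Lemma shanks_phi_rec n : shanks_phi n.+1 =
  (1 + q ^+ n.+1) * shanks_phi n
  + 2 * (-1) ^+ n.+1 * q ^+ (n.+1 * n.+1) * pochp n.+1.
Proof.
have := shanks_phi_telescope (leqnn n).
rewrite /shanks_phi big_ord_recr /= tailmnn pochmS mul1n tailmnn mulr1 tailm0.
set S := \sum_(s < n) _ => tel.
have -> : \sum_(i < n) (-1) ^+ i.+1 * tailm 1 i.+1 n.+1 * pochp i *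
   q ^+ (i.+1 * n.+2) = S + (1 + q ^+ n.+1) *
   \sum_(s < n) (-1) ^+ s.+1 * tailm 1 s.+1 n * pochp s * q ^+ (s.+1 * n.+1).
  rewrite mulr_sumr -big_split /=; apply: eq_bigr => s _.
  rewrite (tailm_recr _ (ltn_ord s)) mul1n [(s.+1 * n.+2)%N]mulnS exprD; ring.
rewrite tel pochpS (_ : n.+1 * n.+2 = n.+1 + n.+1 * n.+1)%N ?exprD; last by nia.
rewrite !exprS; ring.
Qed.

Lemma shanks_phi_eq n :
  pochp n * (1 + 2 * \sum_(s < n) (-1) ^+ s.+1 * q ^+ (s.+1 * s.+1)) = shanks_phi n.
Proof.
elim: n => [|n IHn].
  by rewrite /shanks_phi /pochp /pochm !big_ord0; ring.
rewrite shanks_phi_rec -IHn big_ord_recr /= pochpS; ring.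
Qed.

(** Modulo q^(n+1) only the product survives; letting n grow gives Gauss's identity. *)
Lemma shanks_phi_factor n : shanks_phi n = pochm 1 n + q ^+ n.+1 *
  (2 * \sum_(s < n) (-1) ^+ s.+1 * tailm 1 s.+1 n * pochp s * q ^+ (s * n.+1)).
Proof.
congr (_ + _); rewrite mulrCA; congr (2 * _); rewrite mulr_sumr.
by apply: eq_bigr => s _; rewrite mulSn exprD; ring.
Qed.

Lemma pochpm n : pochp n * pochm 1 n = pochm 2 n.
Proof.
rewrite /pochp /pochm -big_split; apply: eq_bigr => i _ /=.
by rewrite mul1n mul2n -addnn exprD; ring.
Qed.

Definition shanks_psi n :=
  \sum_(s < n) tailm 2 s n * pocho s * q ^+ (s * n.*2.+1).

(** As for phi, the summand compares the s-th terms of [shanks_psi n.+1] and of 1 - q^(2n+1) times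
    [shanks_psi n]. *)
Lemma shanks_psi_telescope n j : (j < n)%N ->
  \sum_(s < j.+1) tailm 2 s n * pocho s * q ^+ (s * n.*2.+1) *
    (q ^+ s.*2 * (1 - q ^+ n.*2.+2) - (1 - q ^+ n.*2.+1))
  = tailm 2 j n * pocho j.+1 * q ^+ (j.+1 * n.*2.+1).
Proof.
elim: j => [|j IHj] ltjn.
  by rewrite big_ord_recr big_ord0 /= pochoS mul0n mul1n !exprS; ring.
rewrite big_ord_recr /= IHj ?(ltnW ltjn) // (tailm_recl _ (ltnW ltjn)) !pochoS.
rewrite mul2n doubleS !(mulSn _ n.*2.+1) !exprD !exprS; ring.
Qed.

Lemma shanks_psi_rec n : shanks_psi n.+1 =
  (1 - q ^+ n.*2.+1) * shanks_psi n
  + (q ^+ (n * n.*2.+1) + q ^+ (n.+1 * n.*2.+1)) * pocho n.+1.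
Proof.
(* The telescoping sum needs at least one term, so n = 0 is treated apart. *)
case: n => [|n].
  rewrite /shanks_psi big_ord0 big_ord1 tailm_recl // tailmnn pochoS.
  by rewrite /pocho big_ord0 mul0n mul1n; ring.
have := shanks_psi_telescope (ltnSn n).
rewrite (tailm_recl _ (ltnSn n)) tailmnn.
set S := \sum_(s < n.+1) _ => tel.
have -> : shanks_psi n.+2 = S + (1 - q ^+ n.+1.*2.+1) * shanks_psi n.+1
    + (1 - q ^+ n.+1.*2.+2) * pocho n.+1 * q ^+ (n.+1 * n.+2.*2.+1).
  rewrite /shanks_psi big_ord_recr /= (tailm_recl _ (ltnSn n.+1)) tailmnn.
  rewrite mul2n doubleS mulr1; congr (_ + _).
  rewrite mulr_sumr -big_split /=; apply: eq_bigr => s _.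
  rewrite (tailm_recr _ (ltnW (ltn_ord s))) mul2n.
  rewrite (_ : s * n.+2.*2.+1 = s * n.+1.*2.+1 + s.*2)%N ?exprD; last by lia.
  rewrite ![n.+2.*2]doubleS; ring.
rewrite tel (pochoS n.+1) mul2n.
rewrite (_ : n.+1 * n.+2.*2.+1 = n.+1 * n.+1.*2.+1 + n.+1.*2)%N ?exprD; last by lia.
rewrite (mulSn n.+1) exprD.
move: (q ^+ (n.+1 * _)) => E; rewrite !doubleS !exprS; ring.
Qed.

Lemma shanks_psi_eq n :
  pocho n * \sum_(s < n.*2) q ^+ 'C(s.+1, 2) = shanks_psi n.
Proof.
elim: n => [|n IHn]; first by rewrite /shanks_psi !big_ord0; ring.
rewrite shanks_psi_rec -IHn doubleS !big_ord_recr /= pochoS.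
rewrite (_ : 'C(n.*2.+1, 2) = n * n.*2.+1)%N; last by rewrite bin2; lia.
rewrite (_ : 'C(n.*2.+2, 2) = n.+1 * n.*2.+1)%N; last by rewrite bin2; lia.
ring.
Qed.

Lemma shanks_psi_factor n : shanks_psi n.+1 = pochm 2 n.+1 + q ^+ n.+1.*2.+1 *
  \sum_(s < n) tailm 2 s.+1 n.+1 * pocho s.+1 * q ^+ (s * n.+1.*2.+1).
Proof.
rewrite /shanks_psi big_ord_recl tailm0 {1}/pocho big_ord0 mul0n !mulr1.
congr (_ + _); rewrite mulr_sumr; apply: eq_bigr => s _.
by rewrite lift0 mulSn exprD; ring.
Qed.

Lemma pochom n : pocho n * pochm 2 n = pochm 1 n.*2.
Proof.
elim: n => [|n IHn]; first by rewrite /pocho /pochm !big_ord0 mulr1.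
by rewrite doubleS !pochmS -IHn pochoS !mul1n mul2n doubleS; ring.
Qed.

End Shanks.

(** Finite form of f_1(-q) f_1(q) f_4 = f_2^3. The even factors give (q^2; q^2)_n squared; the odd
    ones pair to 1 - q^(4i-2), and the factors of [pochm q 4 n] complete them to (q^2; q^2)_(2n). *)
Lemma pochm_oppr (R : comNzRingType) (q : R) n :
  pochm (- q) 1 n.*2 * pochm q 1 n.*2 * pochm q 4 n
  = pochm q 2 n ^+ 2 * pochm q 2 n.*2.
Proof.
elim: n => [|n IHn]; first by rewrite /pochm !big_ord0; ring.
have s0 : (-1) ^+ n.*2 = 1 :> R by rewrite -signr_odd odd_double.
rewrite doubleS !pochmS !mul1n !(exprNn q) !(exprS (-1)) s0.
rewrite (_ : 4 * n.+1 = n.+1.*2 + n.+1.*2)%N; last by lia.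
rewrite !mul2n -!addnn in IHn *.
move: (pochm (- q) 1 _) (pochm q 1 _) (pochm q 4 n) (pochm q 2 n) (pochm q 2 _) IHn.
rewrite !addnS !addSn !exprS !exprD => a b c d e.
move: (q ^+ n) => x IHn.
transitivity (a * b * c * ((1 + q * x ^+ 2) * (1 - q ^+ 2 * x ^+ 2) *
  ((1 - q * x ^+ 2) * (1 - q ^+ 2 * x ^+ 2)) * (1 - q ^+ 4 * x ^+ 4))).
  by ring.
by rewrite IHn; ring.
Qed.

(** * Theta series and Euler products *)

Section Theta.
Variable R : comNzRingType.
Notation q := (fpsX R).
Notation Pm := (pochm (fpsX R)).

(** The Euler product f_k: for k > 0 the factors after the n-th are 1 modulo q^(n+1). *)
Definition eul k : fps R := fun n => Pm k n n.

Lemma pochm_stable k n m i : (0 < k)%N -> (i <= n <= m)%N -> Pm k m i = Pm k n i.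
Proof.
move=> k0 /andP[lein]; elim: m => [|m IHm]; first by rewrite leqn0 => /eqP->.
rewrite leq_eqVlt => /predU1P[-> //|]; rewrite ltnS => le.
rewrite pochmS mulrBr mulr1 fps_subE [_ * q ^+ _]mulrC fpsXn_mulE ifF ?subr0 ?IHm //.
nia.
Qed.

Lemma eul_eqmodX k n m : (0 < k)%N -> (n <= m)%N -> eqmodX n (eul k) (Pm k m).
Proof.
by move=> k0 le i lei; rewrite (@pochm_stable k i m) // leqnn (leq_trans lei).
Qed.

Lemma eul_coef0 k : eul k 0%N = 1.
Proof. by rewrite /eul /pochm big_ord0. Qed.

Lemma subX_pochm j k n : (0 < j)%N -> subX j (Pm k n) = Pm (j * k) n.
Proof.
move=> j0; elim: n => [|n IHn]; first by rewrite /pochm !big_ord0 subX1.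
rewrite !pochmS subXM // IHn raddfB /= subX1 // subXX // subX_fpsX //.
by rewrite -exprM mulnA.
Qed.

Lemma subX_eul j k : (0 < j)%N -> (0 < k)%N -> subX j (eul k) = eul (j * k).
Proof.
move=> j0 k0; apply/funext => n; rewrite [RHS]/eul -subX_pochm // /subX.
case: ifP => // dv; apply: (@eul_eqmodX k n n) => //; exact: leq_div.
Qed.

(** The sum of q^(s^2) over all integers is folded onto s >= 0, so every s > 0 counts twice. *)
Definition phi_coef s : R := if s is 0 then 1 else 2.
Definition phi : fps R := lac phi_coef (fun s => s * s)%N.
Definition phim : fps R := subN phi.
Definition psi : fps R := lac (fun _ => 1) (fun s => 'C(s.+1, 2)).

Lemma leq_self_sqr s : (s <= s * s)%N.
Proof. nia. Qed.

Lemma leq_tri s : (s <= 'C(s.+1, 2))%N.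
Proof. by rewrite binS bin1 leq_addl. Qed.

(** The signs agree because s and s^2 have the same parity. *)
Lemma phimE : phim = lac (fun s => (-1) ^+ s * phi_coef s) (fun s => s * s)%N.
Proof.
apply/funext => n; rewrite /phim /subN /phi /lac mulr_sumr.
apply: eq_bigr => s _; case: eqP => [en|_]; rewrite ?mulr0 // mulrA.
by rewrite -[in RHS]signr_odd -[odd s]andbb -oddM en signr_odd.
Qed.

Lemma phim_eqmodX n :
  eqmodX n phim (1 + 2 * \sum_(s < n) (-1) ^+ s.+1 * q ^+ (s.+1 * s.+1)).
Proof.
rewrite phimE.
have := lac_eqmodX (fun s => (-1) ^+ s * phi_coef s) leq_self_sqr (ltnSn n).
rewrite big_ord_recl /= !mulr1 rmorph1 mulr_sumr.
under eq_bigr => s _ do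
  rewrite rmorphM rmorphXn rmorphN1 rmorph_nat /= [_ * 2]mulrC -mulrA.
done.
Qed.

Lemma shanks_phi_eqmodX n : eqmodX n (shanks_phi q n) (Pm 1 n).
Proof.
rewrite shanks_phi_factor; exact: eqmodX_Xn.
Qed.

(** Gauss's phi(-q) = f_1^2/f_2. Modulo q^(n+1), f_2 splits as [pochp n * pochm 1 n], and Shanks's
    formula turns [pochp n] times the partial theta sum into f_1. *)
Lemma eul_phim : eul 2 * phim = eul 1 ^+ 2.
Proof.
apply: eqmodX_eq => n; exists n => //.
have e k : (0 < k)%N -> eqmodX n (eul k) (Pm k n).
  by move=> k0; exact: eul_eqmodX.
apply: (eqmodX_trans (eqmodX_mul (e 2 isT) (@phim_eqmodX n))).
rewrite -pochpm mulrAC shanks_phi_eq expr2.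
apply: eqmodX_mul; last exact/eqmodX_sym/e.
apply: eqmodX_trans (@shanks_phi_eqmodX n) _; exact/eqmodX_sym/e.
Qed.

Lemma psi_eqmodX n m : (n < m)%N -> eqmodX n psi (\sum_(s < m) q ^+ 'C(s.+1, 2)).
Proof.
move=> lt i le; rewrite /psi (lac_eqmodX _ leq_tri lt le) !fps_sumE.
by apply: eq_bigr => s _; rewrite fpsC_mulE mul1r.
Qed.

Lemma shanks_psi_eqmodX n : eqmodX n (shanks_psi q n.+1) (Pm 2 n.+1).
Proof.
by rewrite shanks_psi_factor; apply: eqmodX_Xn => //; lia.
Qed.

Lemma eul_psi : eul 1 * psi = eul 2 ^+ 2.
Proof.
apply: eqmodX_eq => n; exists n => //.
have e1 : eqmodX n (eul 1) (Pm 1 n.+1.*2) by apply: eul_eqmodX => //; lia.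
have e2 : eqmodX n (eul 2) (Pm 2 n.+1) by apply: eul_eqmodX => //; lia.
have ltn : (n < n.+1.*2)%N by lia.
apply: (eqmodX_trans (eqmodX_mul e1 (psi_eqmodX ltn))).
rewrite -pochom mulrAC shanks_psi_eq expr2.
apply: eqmodX_mul; last exact/eqmodX_sym.
apply: eqmodX_trans (@shanks_psi_eqmodX n) _; exact/eqmodX_sym.
Qed.

Lemma subN_pochm k n : subN (Pm k n) = pochm (- q) k n.
Proof.
rewrite /pochm rmorph_prod; apply: eq_bigr => i _.
by rewrite /= rmorphB rmorph1 rmorphXn /= subN_fpsX.
Qed.

Lemma subN_eul : subN (eul 1) * eul 1 * eul 4 = eul 2 ^+ 3.
Proof.
apply: eqmodX_eq => n; exists n => //.
have e k m : (0 < k)%N -> (n <= m)%N -> eqmodX n (eul k) (Pm k m).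
  exact: eul_eqmodX.
have le2 : (n <= n.*2)%N by lia.
have eN : eqmodX n (subN (eul 1)) (subN (Pm 1 n.*2)).
  by move=> i le; rewrite /subN (e 1 n.*2).
have e1 := e 1 _ isT le2; have e4 := e 4 _ isT (leqnn n).
apply: eqmodX_trans (eqmodX_mul (eqmodX_mul eN e1) e4) _.
rewrite subN_pochm pochm_oppr mulrC [eul 2 ^+ 3]exprS !expr2.
by do 2?[apply: eqmodX_mul]; exact/eqmodX_sym/e.
Qed.

End Theta.

(** * Gauss's relations between phi and psi, and the quartic identity *)

Section ThetaIdentities.
Variable R : comNzRingType.
Implicit Types a b c : fps R.
Notation q := (fpsX R).
Notation eul := (@eul R).
Notation phi := (phi R).
Notation phim := (phim R).
Notation psi := (psi R).

Lemma fps_coef0M a b : (a * b) 0%N = a 0%N * b 0%N.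
Proof. by rewrite fps_mulE big_ord1. Qed.

Lemma fps_coef0X a n : (a ^+ n) 0%N = a 0%N ^+ n.
Proof. by elim: n => // n IHn; rewrite !exprS fps_coef0M IHn. Qed.

(** This permits division by Euler products over any coefficient ring. *)
Lemma fps_mulI a : a 0%N = 1 -> injective ( *%R a).
Proof.
move=> a0 b c /eqP; rewrite -subr_eq0 -mulrBr => /eqP ad; apply: subr0_eq.
move: (b - c) ad => d ad; apply/funext => n; elim/ltn_ind: n => n IHn.
have := congr1 (fun x : fps R => x n) ad.
rewrite fps_mulE big_ord_recl a0 mul1r subn0 big1 ?addr0 // => i _.
by rewrite IHn ?mulr0 // lift0; have := ltn_ord i; lia.
Qed.

Lemma subNK a : subN (subN a) = a.
Proof.
by apply/funext => n; rewrite /subN mulrA -exprD addnn -signr_odd odd_double mul1r.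
Qed.

(** Split by the parity of s: (2s)^2 = 4 s^2 and (2s+1)^2 = 1 + 8 s(s+1)/2. *)
Lemma phi_dissect2 : phi = subX 4 phi + 2 * q * subX 8 psi.
Proof.
rewrite {1}/phi (lac_dissect _ (isT : 0 < 2)%N leq_self_sqr).
rewrite !big_ord_recl big_ord0 addr0 /=; congr (_ + _).
  rewrite (subX_lac _ (isT : 0 < 4)%N leq_self_sqr).
  by apply: eq_lac => s; [case: s => [|s] //; rewrite mulnS | lia].
rewrite (subX_lac _ (isT : 0 < 8)%N leq_tri).
rewrite -mulrA -[q]expr1 fpsXn_lac; last by move=> s; have := leq_tri s; lia.
rewrite -[2 in RHS](rmorph_nat (@fpsC R)) -lac_scale; apply: eq_lac => s.
  by rewrite addnS mulr1.
have : (2 * 'C(s.+1, 2) = s * s.+1)%N.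
  by elim: s => // s; rewrite (binS s.+1) bin1; lia.
by rewrite /= /bump /=; lia.
Qed.

Lemma phi_eul : phi * eul 1 ^+ 2 * eul 4 ^+ 2 = eul 2 ^+ 5.
Proof.
have eN2 : subN (eul 2) = eul 2 by rewrite -(@subX_eul _ 2 1) // subN_subX.
have e : eul 2 * phi = subN (eul 1) ^+ 2.
  by rewrite -rmorphXn /= -eul_phim rmorphM /= eN2 /phim subNK.
apply: (@fps_mulI (eul 2)); first exact: eul_coef0.
move: (subN_eul R) e.
move: (eul 1) (eul 2) (eul 4) phi (subN (eul 1)) => f1 f2 f4 p x e2 e1.
transitivity ((f2 * p) * f1 ^+ 2 * f4 ^+ 2); first by ring.
transitivity ((x * f1 * f4) ^+ 2); first by rewrite e1; ring.
by rewrite e2; ring.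
Qed.

Lemma eul_subX_psi : eul 2 * subX 2 psi = eul 4 ^+ 2.
Proof.
have := congr1 (subX 2) (eul_psi R).
by rewrite subXM // subXX // !subX_eul.
Qed.

Lemma psi_sqr : psi ^+ 2 = phi * subX 2 psi.
Proof.
apply: (@fps_mulI (eul 1 ^+ 2 * eul 4 ^+ 2 * eul 2)).
  by rewrite !fps_coef0M !fps_coef0X !eul_coef0 !expr1n !mulr1.
move: (eul_psi R) eul_subX_psi phi_eul.
move: psi phi (eul 1) (eul 2) (eul 4) (subX 2 psi) => s p f1 f2 f4 s2 e1 e2 e3.
transitivity ((f1 * s) ^+ 2 * f4 ^+ 2 * f2); first by ring.
transitivity (p * f1 ^+ 2 * f4 ^+ 2 * (f2 * s2)); last by ring.
by rewrite e1 e2 e3; ring.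
Qed.

(** The coefficient at n is 0 or minus the one at n/2, so descent ends at the constant term. *)
Lemma subX2_opp_eq0 a : a = - subX 2 a -> a 0%N = 0 -> a = 0.
Proof.
move=> e a0; apply/funext => n; elim/ltn_ind: n => -[//|n] IHn.
rewrite e fps_oppE /subX; case: ifP; last by rewrite oppr0.
by rewrite IHn ?oppr0 //; lia.
Qed.

(* The difference D of both sides satisfies D(q) = - D(q^2). *)
Lemma phi_sqr : phi ^+ 2 = subX 2 phi ^+ 2 + 4 * q * subX 4 psi ^+ 2.
Proof.
apply: subr0_eq; apply: subX2_opp_eq0; last first.
  have q0 : q 0%N = 0 by [].
  rewrite fps_subE fps_addE !fps_coef0M q0 mulr0 mul0r addr0 !fps_coef0X.
  by rewrite /subX /= div0n subrr.
(* With this, D(q) + D(q^2) becomes phi(q)^2 - (phi(q^4) + 2 q psi(q^8))^2, which vanishes by the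
   2-dissection. *)
have AB : subX 4 psi ^+ 2 = subX 4 phi * subX 8 psi.
  by rewrite -subXX // psi_sqr subXM // subX_comp.
rewrite (raddfB (subX 2)) (raddfD (subX 2)) /= !(subXM, subXX) // !subX_comp //=.
have -> : subX 2 4 = 4 :> fps R by rewrite -(rmorph_nat (@fpsC R)) subX_fpsC.
rewrite subX_fpsX // AB {1}phi_dissect2.
by move: (subX 2 phi) (subX 4 phi) (subX 8 psi) q => x y z t; ring.
Qed.

Lemma phim_sqr : phim ^+ 2 = subX 2 phi ^+ 2 - 4 * q * subX 4 psi ^+ 2.
Proof.
rewrite -rmorphXn phi_sqr rmorphD !rmorphM /= !subN_subX // subN_fpsX.
rewrite rmorph_nat.
by move: (subX 2 phi) (subX 4 psi) q => x y z; ring.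
Qed.

(** With A = phi(q^2)^2 and B = 4 q psi(q^4)^2 the left side is (A + B)^2 - (A - B)^2 = 4 A B, and
    psi(q^2)^2 = phi(q^2) psi(q^4). *)
Lemma phi_quartic : phi ^+ 4 - phim ^+ 4 = 16 * q * subX 2 psi ^+ 4.
Proof.
have AB : subX 2 psi ^+ 2 = subX 2 phi * subX 4 psi.
  by rewrite -subXX // psi_sqr subXM // subX_comp.
rewrite (exprM _ 2 2) (exprM phim 2 2) (exprM (subX 2 psi) 2 2).
rewrite AB phi_sqr phim_sqr.
by move: (subX 2 phi) (subX 4 psi) q => x y z; ring.
Qed.

(** The quartic identity multiplied by f_1^8 f_2^4 f_4^8, which clears all denominators; this is u -
    v = 16 z. *)
Lemma eul_quartic :
  eul 2 ^+ 24 - eul 1 ^+ 16 * eul 4 ^+ 8 = 16 * (q * eul 1 ^+ 8 * eul 4 ^+ 16).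
Proof.
move: phi_quartic phi_eul (eul_phim R) eul_subX_psi.
move: phi (eul 1) (eul 2) (eul 4) phim (subX 2 psi) => p f1 f2 f4 pm s2 e e1 e2 e3.
move: q e => x e.
transitivity ((p * f1 ^+ 2 * f4 ^+ 2) ^+ 4 * f2 ^+ 4
  - f1 ^+ 8 * (f2 * pm) ^+ 4 * f4 ^+ 8).
  by rewrite e1 e2; ring.
transitivity (f1 ^+ 8 * f4 ^+ 8 * f2 ^+ 4 * (p ^+ 4 - pm ^+ 4)); first by ring.
transitivity (16 * (x * f1 ^+ 8 * f4 ^+ 8 * (f2 * s2) ^+ 4)).
  by rewrite e; ring.
by rewrite e3; ring.
Qed.

Lemma phim_cube_coef n : (phim ^+ 3) (8 * n + 7)%N = 0.
Proof.
have e : phim ^+ 3 = subN (phi ^+ 3) by rewrite rmorphXn.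
suff h : (phi ^+ 3) (8 * n + 7)%N = 0 by rewrite e /subN h mulr0.
have sq i : (forall s, (s * s)%N != i) -> phi i = 0.
  move=> h; rewrite /phi /lac big1 // => s _.
  by rewrite (negPf (h s)) mulr0.
rewrite !exprS expr0 mulr1 fps_mulE big1 // => i _.
rewrite fps_mulE mulr_sumr big1 // => j _.
have [si|/negP ni] := boolP (phi i == 0); first by rewrite (eqP si) mul0r.
have [sj|/negP nj] := boolP (phi j == 0); first by rewrite (eqP sj) mul0r mulr0.
(* Squares are 0, 1 or 4 modulo 8, and three such residues never add up to 7. *)
have key (a : nat) : ~ phi a == 0 -> (a %% 8 \in [:: 0; 1; 4])%N.
  move=> na; have [s <-] : exists s, (s * s)%N = a.
    apply: contrapT => h; apply: na; apply/eqP/sq => s; apply/eqP => es.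
    by apply: h; exists s.
  rewrite -modnMm; have := ltn_pmod s (isT : 0 < 8)%N.
  by case: (s %% 8)%N => [|[|[|[|[|[|[|[|]]]]]]]].
have [sk|/negP nk] := boolP (phi ((8 * n + 7 - i) - j)%N == 0).
  by rewrite (eqP sk) !mulr0.
have := key _ ni; have := key _ nj; have := key _ nk; rewrite !inE.
have := ltn_ord i; have := ltn_ord j; lia.
Qed.

End ThetaIdentities.

(** * Sums of two squares *)

Fixpoint box (n : nat) : seq int :=
  if n is m.+1 then n%:Z :: - n%:Z :: box m else [:: 0].

Lemma mem_box n x : (x \in box n) = (`|x| <= n)%N.
Proof. by elim: n => [|n IHn] /=; rewrite !inE ?IHn; lia. Qed.

Lemma box_uniq n : uniq (box n).
Proof. by elim: n => //= n ->; rewrite !inE !mem_box; lia. Qed.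

Definition norm2 (p : int * int) : int := p.1 * p.1 + p.2 * p.2.

(** The box of radius n contains all solutions, since |x| <= x^2 <= n. *)
Definition reps (n : nat) : seq (int * int) :=
  [seq p <- [seq (x, y) | x <- box n, y <- box n] | norm2 p == n%:Z].

Lemma mem_reps n p : (p \in reps n) = (norm2 p == n%:Z).
Proof.
rewrite mem_filter; case: eqP => //= e; apply/allpairsP; exists p.
by case: p e => x y /= e; rewrite !mem_box; split=> //; rewrite /norm2 /= in e; nia.
Qed.

Lemma reps_uniq n : uniq (reps n).
Proof.
by rewrite filter_uniq // allpairs_uniq ?box_uniq // => -[? ?] [? ?] _ _ [-> ->].
Qed.

Lemma size_reps_bij n m (L : pred (int * int)) g : injective g ->
  (forall p, norm2 p == n%:Z -> L (g p) && (norm2 (g p) == m%:Z)) ->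
  (forall p, L p -> norm2 p == m%:Z -> exists2 p', norm2 p' == n%:Z & p = g p') ->
  count L (reps m) = size (reps n).
Proof.
move=> ginj gP gS; rewrite -size_filter -(size_map g (reps n)).
apply/perm_size/uniq_perm.
- by rewrite filter_uniq ?reps_uniq.
- by rewrite map_inj_uniq ?reps_uniq.
move=> p; rewrite mem_filter mem_reps; apply/andP/mapP.
  by case=> Lp np; have [p' np' ->] := gS p Lp np; exists p' => //; rewrite mem_reps.
by case=> p'; rewrite mem_reps => np' ->; have /andP := gP _ np'.
Qed.

(* Multiplication by 1 + 2i, alone or followed by conjugation, maps the
   representations of n onto the representations x^2 + y^2 of 5n for which 5
   divides y - 2x, respectively y + 2x; every representation of 5n is of one of
   these two kinds, and of both exactly when 5 divides x and y. *)
Lemma size_reps5 n : (size (reps (5 * n)) +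
  (if 5 %| n then size (reps (n %/ 5)) else 0) = 2 * size (reps n))%N.
Proof.
pose L1 (p : int * int) := (5 %| p.2 - 2 * p.1)%Z.
pose L2 (p : int * int) := (5 %| p.2 + 2 * p.1)%Z.
have c1 : count L1 (reps (5 * n)) = size (reps n).
  apply: (@size_reps_bij _ _ _ (fun p => (p.1 - 2 * p.2, 2 * p.1 + p.2))).
  - by move=> [x y] [x' y'] [] ? ?; congr (_, _); lia.
  - by case=> x y; rewrite /norm2 /L1 /= => ?; apply/andP; split; lia.
  - case=> x y; rewrite /norm2 /L1 /= => /dvdzP[t e] ?.
    (* With y - 2x = 5t, this is the preimage of (x, y) under multiplication by 1 + 2i. *)
    by exists (x + 2 * t, t); [rewrite /=; lia | congr (_, _); rewrite /=; lia].
have c2 : count L2 (reps (5 * n)) = size (reps n).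
  apply: (@size_reps_bij _ _ _ (fun p => (p.1 - 2 * p.2, - (2 * p.1 + p.2)))).
  - by move=> [x y] [x' y'] [] ? ?; congr (_, _); lia.
  - by case=> x y; rewrite /norm2 /L2 /= => ?; apply/andP; split; lia.
  - case=> x y; rewrite /norm2 /L2 /= => /dvdzP[t e] ?.
    by exists (x - 2 * t, - t); [rewrite /=; lia | congr (_, _); rewrite /=; lia].
(* Both divisibilities hold exactly when x = 5a and y = 5b; then a^2 + b^2 = n/5, which requires
   that 5 divide n. *)
have c3 : count (predI L1 L2) (reps (5 * n)) =
          if (5 %| n)%N then size (reps (n %/ 5)) else 0%N.
  case: ifP => [/dvdnP[k ->]|ndv].
    rewrite mulnK //; apply: (@size_reps_bij _ _ _ (fun p => (5 * p.1, 5 * p.2))).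
    - by move=> [x y] [x' y'] [] ? ?; congr (_, _); lia.
    - by case=> x y; rewrite /norm2 /L1 /L2 /= => ?; apply/andP; split; lia.
    - case=> x y; rewrite /norm2 /L1 /L2 /= => /andP[? ?] ?.
      have [a ea] : exists a, x = 5 * a by exists (x %/ 5)%Z; lia.
      have [b eb] : exists b, y = 5 * b by exists (y %/ 5)%Z; lia.
      by exists (a, b); [rewrite /=; nia | congr (_, _)].
  apply/eqP; rewrite -leqn0 leqNgt -has_count; apply/hasPn => -[x y].
  rewrite mem_reps /norm2 /L1 /L2 /= => ?; apply/negP => /andP[? ?].
  have [a ea] : exists a, x = 5 * a by exists (x %/ 5)%Z; lia.
  have [b eb] : exists b, y = 5 * b by exists (y %/ 5)%Z; lia.
  by subst; lia.
(* Modulo 5, x^2 + y^2 = (y - 2x)(y + 2x), so one factor is divisible by 5; the 25 pairs of residues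
   are checked. *)
have cU : count (predU L1 L2) (reps (5 * n)) = size (reps (5 * n)).
  apply/eqP; rewrite -all_count; apply/allP => -[x y].
  rewrite mem_reps /norm2 /L1 /L2 /= => /eqP h.
  have [a [r [ex]]] : exists a r, x = 5 * a + r /\ (r \in [:: 0; 1; 2; 3; 4]).
    by exists (x %/ 5)%Z, (x %% 5)%Z; rewrite !inE; lia.
  have [b [s [ey]]] : exists b s, y = 5 * b + s /\ (s \in [:: 0; 1; 2; 3; 4]).
    by exists (y %/ 5)%Z, (y %% 5)%Z; rewrite !inE; lia.
  subst x y; rewrite !inE => /or4P hs /or4P hr.
  by case: hr => [|||/orP[]] /eqP er; case: hs => [|||/orP[]] /eqP es; subst r s; lia.
by rewrite -c3 -cU count_predUI c1 c2 mul2n addnn.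
Qed.

Section TwoSquares.
Variable R : comNzRingType.
Notation q := (fpsX R).
Notation phi := (phi R).

Lemma phi_box n m : (n <= m)%N ->
  phi n = \sum_(x <- box m) (x * x == n%:Z)%:R.
Proof.
move=> le; rewrite /phi (lacE _ leq_self_sqr (leq_ltn_trans le (ltnSn m))) {le}.
elim: m => [|m IHm].
  by rewrite big_ord1 big_seq1 mul1r /=; congr (nat_of_bool _)%:R; lia.
rewrite big_ord_recr /= IHm !big_cons mulrNN.
have -> : (m.+1%:Z * m.+1%:Z == n%:Z) = (m.+1 * m.+1 == n)%N by lia.
by case: eqP => _; rewrite ?mulr0 ?addr0 ?add0r // mulr1 addrC addrA.
Qed.

Lemma phi_sqr_reps n : (phi ^+ 2) n = (size (reps n))%:R.
Proof.
rewrite expr2 fps_mulE.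
transitivity (\sum_(x <- box n) \sum_(y <- box n) (x * x + y * y == n%:Z)%:R : R).
  under eq_bigr => i _.
    rewrite (phi_box (ltn_ord i : (i <= n)%N)) (phi_box (leq_subr i n)) mulr_suml.
    under eq_bigr => x _ do rewrite mulr_sumr.
    over.
  rewrite exchange_big /=; apply: eq_bigr => x _.
  rewrite exchange_big /=; apply: eq_bigr => y _.
  case: eqP => [e|ne].
    have x0 : 0 <= x * x by nia.
    have y0 : 0 <= y * y by nia.
    have lt : (absz (x * x)%R < n.+1)%N by lia.
    (* For fixed x and y only the index i = x^2 of the Cauchy product contributes. *)
    rewrite (bigD1 (Ordinal lt)) //= big1 ?addr0 => [|i]; last first.
      rewrite -val_eqE /= => ni; case: eqP => [ei|]; last by rewrite mul0r.
      by move: ni; rewrite ei; lia.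
    have -> : (x * x == absz (x * x)%R) by lia.
    have -> : (y * y == (n - absz (x * x)%R)%N) by lia.
    by rewrite mulr1.
  rewrite big1 // => i _; have := ltn_ord i.
  case: eqP => [ex|]; rewrite ?mul0r //; case: eqP => [ey|]; rewrite ?mulr0 //; lia.
rewrite /reps size_filter -sum1_count natr_sum [RHS]big_mkcond big_allpairs.
apply: eq_bigr => x _; apply: eq_bigr => y _; rewrite /norm2 /=; by case: ifP.
Qed.

Lemma fpsU5_phi_sqr : fpsU 5 (phi ^+ 2) = 2 * phi ^+ 2 - subX 5 phi ^+ 2.
Proof.
apply/funext => n; rewrite fps_subE -subXX // /subX /fpsU !phi_sqr_reps.
have -> : (2 * phi ^+ 2) n = 2 * (phi ^+ 2) n.
  by rewrite -(rmorph_nat (@fpsC R)) fpsC_mulE.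
rewrite phi_sqr_reps -natrM -size_reps5 natrD.
by case: ifP => _; rewrite ?addrK ?addr0 ?subr0.
Qed.

End TwoSquares.

(** * Reduction modulo 5 *)

Section Dissect5.
Variable R : comNzRingType.
Notation q := (fpsX R).
Notation phi := (phi R).

(** Squares are 0, 1 or 4 modulo 5; the class s = 0 gives phi(q^25), the classes 1 and 4 give b, and
    2 and 3 give c. *)
Lemma phi_dissect5 : exists b c : fps R,
  phi = subX 5 (subX 5 phi) + q * subX 5 b + q ^+ 4 * subX 5 c.
Proof.
pose g e : fps R := lac (fun _ => 2) e.
(* The exponents come from (5s+1)^2 = 1 + 5(5s^2+2s), (5s+4)^2 = 1 + 5(5s^2+8s+3), and likewise for
   5s+2 and 5s+3. *)
exists (g (fun s => 5 * (s * s) + 2 * s)%N + g (fun s => 5 * (s * s) + 8 * s + 3)%N).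
exists (g (fun s => 5 * (s * s) + 4 * s)%N + g (fun s => 5 * (s * s) + 6 * s + 1)%N).
have gE k e r j : (forall s, s <= e s)%N ->
    (forall s, (5 * s + r) * (5 * s + r) = k + 5 * e s)%N -> (0 < r)%N -> j = r ->
    lac (fun s => phi_coef R (5 * s + j)) (fun s => (5 * s + j) * (5 * s + j))%N
    = q ^+ k * subX 5 (g e).
  move=> le es r0 ->; rewrite (subX_lac _ (isT : 0 < 5)%N le) fpsXn_lac.
    by apply: eq_lac => s; rewrite ?es //; case: r r0 {es} => // r _; rewrite addnS.
  by move=> s; have := le s; lia.
rewrite {1}/phi (lac_dissect _ (isT : 0 < 5)%N leq_self_sqr).
rewrite !big_ord_recl big_ord0 addr0 !raddfD /=.
rewrite (gE 1 (fun s => 5 * (s * s) + 2 * s) 1 (bump 0 0))%N //;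
  try by move=> s; lia.
rewrite (gE 4 (fun s => 5 * (s * s) + 4 * s) 2 (bump 0 (bump 0 0)))%N //;
  try by move=> s; lia.
rewrite (gE 4 (fun s => 5 * (s * s) + 6 * s + 1) 3
  (bump 0 (bump 0 (bump 0 0))))%N //; try by move=> s; lia.
rewrite (gE 1 (fun s => 5 * (s * s) + 8 * s + 3) 4
  (bump 0 (bump 0 (bump 0 (bump 0 0)))))%N //; try by move=> s; lia.
rewrite subX_comp // -[phi]/(lac _ _) (subX_lac _ (isT : 0 < 5 * 5)%N leq_self_sqr).
rewrite (@eq_lac _ _ (phi_coef R) _ (fun s => 5 * 5 * (s * s))%N); first last.
- by move=> s /=; lia.
- by case=> [|s] //; rewrite addn0 mulnS.
move: (subX 5 (g (fun s => 5 * (s * s) + 2 * s)%N)) => x.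
move: (subX 5 (g (fun s => 5 * (s * s) + 4 * s)%N)) => y.
move: (subX 5 (g (fun s => 5 * (s * s) + 6 * s + 1)%N)) => z.
move: (subX 5 (g (fun s => 5 * (s * s) + 8 * s + 3)%N)) => t.
by move: (lac _ _) q => u v; ring.
Qed.

Lemma fpsU5_sqr (a b c d e : fps R) :
  fpsU 5 ((subX 5 a + q * subX 5 b + q ^+ 2 * subX 5 c + q ^+ 3 * subX 5 d
           + q ^+ 4 * subX 5 e) ^+ 2)
  = a ^+ 2 + 2 * q * (b * e + c * d).
Proof.
have q5 : subX 5 q = q ^+ 5 by rewrite subX_fpsX.
(* [A0] to [A4] collect the products by exponent modulo 5; index sums of 5 or more carry an extra q.
   Only [A0] survives. *)
pose A0 := a ^+ 2 + q * (b * e + c * d) + q * (b * e + c * d).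
pose A1 := a * b + a * b + q * (c * e + c * e + d * d).
pose A2 := a * c + a * c + b * b + q * (d * e + d * e).
pose A3 := a * d + a * d + b * c + b * c + q * (e * e).
pose A4 := a * e + a * e + b * d + b * d + c * c.
rewrite (_ : _ ^+ 2 = subX 5 A0 + q ^+ 1 * subX 5 A1 + q ^+ 2 * subX 5 A2
   + q ^+ 3 * subX 5 A3 + q ^+ 4 * subX 5 A4); last first.
  have sD (x y : fps R) : subX 5 (x + y) = subX 5 x + subX 5 y by exact: raddfD.
  have sM (x y : fps R) : subX 5 (x * y) = subX 5 x * subX 5 y by exact: subXM.
  rewrite /A0 /A1 /A2 /A3 /A4 expr2 !(sD, sM) q5.
  move: (subX 5 a) (subX 5 b) (subX 5 c) (subX 5 d) (subX 5 e) q => ? ? ? ? ? ?.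
  ring.
rewrite !fpsUD fpsU_subX // !fpsU_Xn_subX // !addr0 /A0.
by move: q => ?; ring.
Qed.

End Dissect5.

Notation F5 := 'F_5.

Lemma F5_char (x : fps F5) : 5 * x = 0.
Proof.
rewrite -(rmorph_nat (@fpsC F5)); apply/funext => n; rewrite fpsC_mulE.
by rewrite (_ : 5%:R = 0 :> F5) ?mul0r //; apply/val_inj.
Qed.

(** Fifth powers are additive in characteristic 5 and fix constants; splitting off the constant term
    relates the coefficient of q^n to that of q^(n-5) of the shifted series. *)
Lemma fps_frobenius5 (a : fps F5) : a ^+ 5 = subX 5 a.
Proof.
have F x : fpsC x ^+ 5 = fpsC x :> fps F5.
  rewrite -rmorphXn /=; congr fpsC.
  by case: x => [[|[|[|[|[|]]]]] ltx] //; apply/val_inj.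
have H (x y : fps F5) : (x + y) ^+ 5 = x ^+ 5 + y ^+ 5.
  transitivity (x ^+ 5 + y ^+ 5 +
    5 * (x ^+ 4 * y + 2 * x ^+ 3 * y ^+ 2 + 2 * x ^+ 2 * y ^+ 3 + x * y ^+ 4)).
    by ring.
  by rewrite F5_char addr0.
apply/funext => n; elim/ltn_ind: n a => n IHn a.
rewrite (fps_split0 a) H F raddfD /= subX_fpsC // subXM // subX_fpsX // exprMn.
rewrite !fps_addE !fpsXn_mulE; case: leqP => // le5n; rewrite IHn //; lia.
Qed.

(** With [al] = phi(q^5) and T = q b c, the two evaluations of U_5(phi^2) give T = phi^2 - al^2
    modulo 5. Dissecting phi^2 once more expresses U_5(phi^4) through [al] and T. *)
Lemma fpsU5_phi4 : fpsU 5 (phi F5 ^+ 4) = phi F5 ^+ 4.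
Proof.
have [b [c e]] := phi_dissect5 F5.
pose al := subX 5 (phi F5); pose T := fpsX F5 * (b * c).
have e1 : fpsU 5 (phi F5 ^+ 2) = al ^+ 2 + 2 * T.
  have := fpsU5_sqr al b 0 0 c.
  rewrite !raddf0 !mulr0 !addr0 -e => ->.
  by rewrite /T; move: (fpsX F5) => x; ring.
have eT : T = phi F5 ^+ 2 - al ^+ 2.
  have := fpsU5_phi_sqr F5; rewrite e1 -/al; move: (phi F5) (al) (T) => p a t h.
  (* 3 is the inverse of 2 modulo 5. *)
  transitivity (3 * (a ^+ 2 + 2 * t) - 3 * a ^+ 2 - 5 * t); first by ring.
  rewrite F5_char subr0 h.
  transitivity (p ^+ 2 - a ^+ 2 + 5 * (p ^+ 2 - a ^+ 2)); first by ring.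
  by rewrite F5_char addr0.
have -> : phi F5 ^+ 4 = (phi F5 ^+ 2) ^+ 2 by rewrite -exprM.
(* The five components of phi^2; the square of the q^4 term has leading factor q^8 = q^3 q^5, whence
   the q beside c^2. *)
have e2 : phi F5 ^+ 2 = subX 5 (al ^+ 2 + 2 * T) + fpsX F5 * subX 5 (2 * al * b)
    + fpsX F5 ^+ 2 * subX 5 (b ^+ 2) + fpsX F5 ^+ 3 * subX 5 (fpsX F5 * c ^+ 2)
    + fpsX F5 ^+ 4 * subX 5 (2 * al * c).
  have n2 : subX 5 2 = 2 :> fps F5 by rewrite -(rmorph_nat (@fpsC F5)) subX_fpsC.
  rewrite {1}e -/al /T !(raddfD (subX 5)) /= !(subXM, subXX) // subX_fpsX // n2.
  move: (subX 5 al) (subX 5 b) (subX 5 c) (fpsX F5) => x y z t.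
  ring.
rewrite {1}e2 fpsU5_sqr.
transitivity (al ^+ 4 + 12 * al ^+ 2 * T + 6 * T ^+ 2).
  by rewrite /T; move: (al) (fpsX F5) => x y; ring.
rewrite eT; move: (al) (phi F5 ^+ 2) => x y.
transitivity (y ^+ 2 + 5 * (y ^+ 2 - x ^+ 4)); first by ring.
by rewrite F5_char addr0.
Qed.

(** The sign twist commutes with U_5 because 5n and n have the same parity. *)
Lemma fpsU5_phim4 : fpsU 5 (phim F5 ^+ 4) = phim F5 ^+ 4.
Proof.
have e : phim F5 ^+ 4 = subN (phi F5 ^+ 4) by rewrite rmorphXn.
rewrite e -{2}fpsU5_phi4; apply/funext => n; rewrite /fpsU /subN /=.
by rewrite -signr_odd oddM /= signr_odd.
Qed.

Lemma inv_phim_coef (P : fps F5) n : P * phim F5 = 1 -> P (40 * n + 35)%N = 0.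
Proof.
move=> h.
have -> : (40 * n + 35 = 5 * (8 * n + 7))%N by lia.
rewrite -[LHS]/(fpsU 5 P (8 * n + 7)%N).
have -> : fpsU 5 P = phim F5 ^+ 3.
  (* P = P^5 phi(-q)^4, and the factor P(q^5) then leaves U_5 as P. *)
  have -> : P = subX 5 P * phim F5 ^+ 4.
    rewrite -fps_frobenius5; move: (phim F5) h => p h.
    transitivity (P * (P * p) ^+ 4); last by ring.
    by rewrite h expr1n mulr1.
  rewrite fpsU_mul_subX // fpsU5_phim4; move: (phim F5) h => p h.
  transitivity ((P * p) * p ^+ 3); first by ring.
  by rewrite h mul1r.
exact: phim_cube_coef.
Qed.

(** * Transfer from integer series to series over F_5 *)

Definition red (a : series) : fps F5 := fun n => (a n)%:~R.

Lemma cong5P a b : red a = red b -> cong5 a b.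
Proof.
move=> h n; apply/eqP; rewrite eqz_mod_dvd.
rewrite (dvdz_pcharf (pchar_Fp (isT : prime 5))) rmorphB subr_eq0.
by apply/eqP; exact: (congr1 (fun x : fps F5 => x n) h).
Qed.

Lemma red_mul a b : red (smul a b) = red a * red b.
Proof.
apply/funext => n; rewrite /red /smul fps_mulE rmorph_sum.
by apply: eq_bigr => i _; rewrite rmorphM.
Qed.

Lemma red_one : red sone = 1.
Proof. by apply/funext => n; rewrite /red /sone fps_oneE rmorph_nat. Qed.

Lemma red_pow a k : red (spow a k) = red a ^+ k.
Proof. by elim: k => [|k IHk]; rewrite ?red_one // exprS -IHk -red_mul. Qed.

Lemma red_add a b : red (sadd a b) = red a + red b.
Proof. by apply/funext => n; rewrite /red /sadd rmorphD. Qed.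

Lemma red_scale (c : int) a : red (sscale c a) = c%:~R * red a.
Proof.
apply/funext => n; rewrite -(rmorph_int (@fpsC F5)) fpsC_mulE /red /sscale.
by rewrite rmorphM.
Qed.

Lemma red_q : red sq = fpsX F5.
Proof. by apply/funext => n; rewrite /red /sq /fpsX rmorph_nat. Qed.

Lemma coef_pochm_red m k n :
  ((\prod_(i < k) (1 - 'X^(m * i.+1)%N) : {poly int})`_n)%:~R
  = pochm (fpsX F5) m k n.
Proof.
elim: k n => [|k IHk] n.
  by rewrite /pochm !big_ord0 coef1 fps_oneE rmorph_nat.
rewrite pochmS big_ord_recr /= !mulrBr !mulr1 coefB rmorphB fps_subE -IHk /=.
by rewrite coefMXn mulrC fpsXn_mulE ltnNge; case: leqP => //= _; rewrite -IHk.
Qed.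

Lemma red_f m : red (f m) = eul F5 m.
Proof. by apply/funext => n; exact: coef_pochm_red. Qed.

Lemma size_invs a n : size (invs a n) = n.+1.
Proof. by elim: n => //= n IHn; rewrite size_rcons IHn. Qed.

Lemma nth_invs a n m : (n <= m)%N -> nth 0 (invs a m) n = sinv a n.
Proof.
elim: m => [|m IHm]; first by rewrite leqn0 => /eqP->.
rewrite leq_eqVlt => /predU1P[-> //|]; rewrite ltnS => le.
by rewrite /= nth_rcons size_invs ltnS le IHm.
Qed.

Lemma smul_sinv a : a 0%N = 1 -> smul a (sinv a) = sone.
Proof.
move=> a0; apply/funext => -[|n]; rewrite /smul /sone.
  by rewrite big_ord1 a0 mul1r.
rewrite big_ord_recl a0 mul1r subn0 {1}/sinv /= nth_rcons size_invs ltnn eqxx.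
rewrite big_add1 /= big_mkord; apply/eqP; rewrite addrC subr_eq0; apply/eqP.
apply: eq_bigr => i _; rewrite nth_invs ?lift0 //; lia.
Qed.

Lemma red_f_inv m : eul F5 m * red (sinv (f m)) = 1.
Proof. by rewrite -red_f -red_mul smul_sinv ?red_one // /f big_ord0 coef1. Qed.

(** * Vanishing of the right-hand side *)

Lemma quintic_combination_eq0 (y u v z t1 t2 t3 t4 t5 t6 t7 t8 : fps F5) :
  u - v = 16 * z ->
  t1 = y * u ^+ 5 -> t2 = y * (u * v ^+ 4) -> t3 = y * (u ^+ 4 * z) ->
  t4 = y * (z * v ^+ 4) -> t5 = y * (u ^+ 3 * z ^+ 2) ->
  t6 = y * (u ^+ 2 * z ^+ 3) -> t7 = y * (u * z ^+ 4) -> t8 = y * z ^+ 5 ->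
  2 * t1 + (3 * t2 + (4 * t3 + (3 * t4 + (4 * t5 + (4 * t6 + (4 * t7 + 2 * t8))))))
  = 0.
Proof.
move=> e -> -> -> -> -> -> -> ->.
have -> : v = u - z.
  transitivity (u - (u - v)); first by ring.
  rewrite e; transitivity (u - z - 5 * (3 * z)); first by ring.
  by rewrite F5_char subr0.
(* Expansion after v = u - z, in which every coefficient is a multiple of 5. *)
transitivity (5 * (y * (u ^+ 5 - u ^+ 4 * z + 2 * u ^+ 3 * z ^+ 2
    + 2 * u ^+ 2 * z ^+ 3 - u * z ^+ 4 + z ^+ 5))); first by ring.
exact: F5_char.
Qed.

Lemma eta_combination_eq0 (f1 f2 f4 i1 i4 x : fps F5) :
  f2 ^+ 24 - f1 ^+ 16 * f4 ^+ 8 = 16 * (x * f1 ^+ 8 * f4 ^+ 16) ->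
  f1 * i1 = 1 -> f4 * i4 = 1 ->
  2 * (f2 ^+ 122 * (i1 ^+ 63 * i4 ^+ 40))
  + (3 * (f1 * (f2 ^+ 26 * i4 ^+ 8))
  + (4 * (x * (f2 ^+ 98 * (i1 ^+ 55 * i4 ^+ 24)))
  + (3 * (x * (f1 ^+ 9 * (f2 ^+ 2 * f4 ^+ 8)))
  + (4 * (x ^+ 2 * (f2 ^+ 74 * (i1 ^+ 47 * i4 ^+ 8)))
  + (4 * (x ^+ 3 * (f2 ^+ 50 * (f4 ^+ 8 * i1 ^+ 39)))
  + (4 * (x ^+ 4 * (f2 ^+ 26 * (f4 ^+ 24 * i1 ^+ 31)))
  + 2 * (x ^+ 5 * (f2 ^+ 2 * (f4 ^+ 40 * i1 ^+ 23))))))))) = 0.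
Proof.
move=> e h1 h4.
(* Each term is padded with powers of f_1 i_1 = 1 and f_4 i_4 = 1 until it carries the common factor
   i_1^63 i_4^40. *)
have cancel a b y : y * ((f1 * i1) ^+ a * (f4 * i4) ^+ b) = y.
  by rewrite h1 h4 !expr1n !mulr1.
apply: (quintic_combination_eq0 (y := f2 ^+ 2 * i1 ^+ 63 * i4 ^+ 40) e).
- by ring.
- by rewrite -[LHS](cancel 63 32); ring.
- by rewrite -[LHS](cancel 8 16); ring.
- by rewrite -[LHS](cancel 63 40); ring.
- by rewrite -[LHS](cancel 16 32); ring.
- by rewrite -[LHS](cancel 24 40); ring.
- by rewrite -[LHS](cancel 32 40); ring.
- by rewrite -[LHS](cancel 40 40); ring.
Qed.

Theorem theorem2p3 :
  cong5 (fun n => pbar (40 * n + 35)%N)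
   (sadd (sscale 2 (smul (spow (f 2) 122)
                    (smul (spow (sinv (f 1)) 63) (spow (sinv (f 4)) 40))))
   (sadd (sscale 3 (smul (f 1) (smul (spow (f 2) 26) (spow (sinv (f 4)) 8))))
   (sadd (sscale 4 (smul sq (smul (spow (f 2) 98)
                    (smul (spow (sinv (f 1)) 55) (spow (sinv (f 4)) 24)))))
   (sadd (sscale 3 (smul sq (smul (spow (f 1) 9)
                    (smul (spow (f 2) 2) (spow (f 4) 8)))))
   (sadd (sscale 4 (smul (spow sq 2) (smul (spow (f 2) 74)
                    (smul (spow (sinv (f 1)) 47) (spow (sinv (f 4)) 8)))))
   (sadd (sscale 4 (smul (spow sq 3) (smul (spow (f 2) 50)
                    (smul (spow (f 4) 8) (spow (sinv (f 1)) 39)))))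
   (sadd (sscale 4 (smul (spow sq 4) (smul (spow (f 2) 26)
                    (smul (spow (f 4) 24) (spow (sinv (f 1)) 31)))))
         (sscale 2 (smul (spow sq 5) (smul (spow (f 2) 2)
                    (smul (spow (f 4) 40) (spow (sinv (f 1)) 23)))))))))))).
Proof.
apply: cong5P.
have -> : red (fun n => pbar (40 * n + 35)%N) = 0.
  apply/funext => n; rewrite -[LHS]/(red pbar (40 * n + 35)%N).
  apply: inv_phim_coef.
  rewrite -[pbar]/(smul (f 2) (spow (sinv (f 1)) 2)) red_mul red_pow red_f.
  move: (eul_phim F5) (red_f_inv 1).
  move: (eul F5 1) (eul F5 2) (phim F5) (red (sinv (f 1))) => f1 f2 p i1 e h.
  (* The overpartition series f_2/f_1^2 is inverse to phi(-q), because f_2 phi(-q) = f_1^2. *)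
  transitivity ((f2 * p) * i1 ^+ 2); first by ring.
  by rewrite e -exprMn h expr1n.
symmetry.
apply: etrans
  (eta_combination_eq0 (eul_quartic F5) (red_f_inv 1) (red_f_inv 4)).
(* Both sides are nested in the same way, so it suffices to push [red] down to the leaves. *)
repeat lazymatch goal with
| |- red (sadd _ _) = _ => rewrite red_add; congr (_ + _)
| |- red (sscale _ _) = _ => rewrite red_scale rmorph_nat; congr (_ * _)
| |- red (smul _ _) = _ => rewrite red_mul; congr (_ * _)
| |- red (spow _ _) = _ => rewrite red_pow; congr (_ ^+ _)
| |- red sq = _ => exact: red_q
| |- red (f _) = _ => exact: red_f
| |- _ => reflexivity
end.
Qed.
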